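(* Let $n\ge 2$, $Q=I-\frac1nJ$, and for $z=(z_1,\dots,z_n)\in\mathbb{C}^n$ let $T(z)=Q\,\mathrm{diag}(z_1,\dots,z_n)\,Q$. For every $z\in\mathbb{C}^n$ with $\sum_{j=1}^n z_j=0$, \[ \|T(z)\|_{S_1}\le\sqrt{\frac{n-2}{n}}\;\sum_{j=1}^n|z_j| . \]
   Context: $I$ is the $n\times n$ identity matrix and $J$ the $n\times n$ all-ones matrix. For an $n\times n$ complex matrix $X$ with singular values $\sigma_1(X)\ge\dots\ge\sigma_n(X)$, the Schatten $p$-norm is $\|X\|_{S_p}=(\sum_k\sigma_k(X)^p)^{1/p}$ for $1\le p<\infty$; in particular $\|X\|_{S_1}=\sum_k\sigma_k(X)$ (the trace norm). *)

(* Defs.v *)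
(* Complex numbers are modelled as R[i] = complex R for
   R : realType (so R[i] is the field of complex numbers), which is a
   numClosedFieldType. *)
From HB Require Import structures.
From mathcomp Require Import all_boot all_order all_algebra.
From mathcomp Require Import reals.
From mathcomp Require Import complex.
Set Implicit Arguments. Unset Strict Implicit. Unset Printing Implicit Defensive.
Import Order.TTheory GRing.Theory Num.Theory.
Local Open Scope ring_scope.

Section Schatten.
Variable C : numClosedFieldType.

(* The eigenvalues (with algebraic multiplicity) of a square matrix:
   a sequence r with char_poly A = \prod_(z <- r) ('X - z) (char_poly is monic). *)
Definition eigvals (n : nat) (A : 'M[C]_n) : seq C :=
  sval (closed_field_poly_normal (char_poly A)).

Definition adjmx (m n : nat) (A : 'M[C]_(m, n)) : 'M[C]_(n, m) :=
  (map_mx Num.conj A)^T.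

Definition singvals (n : nat) (X : 'M[C]_n) : seq C :=
  [seq sqrtC l | l <- eigvals (adjmx X *m X)].

Definition trace_norm (n : nat) (X : 'M[C]_n) : C :=
  \sum_(s <- singvals X) s.
End Schatten.

Definition Qmx (C : numClosedFieldType) (n : nat) : 'M[C]_n :=
  1%:M - (n%:R)^-1 *: const_mx 1.

Definition Tmx (C : numClosedFieldType) (n : nat) (z : 'rV[C]_n) : 'M[C]_n :=
  Qmx C n *m diag_mx z *m Qmx C n.

(* Main.v *)
(* With L = sum |z_j|, w_j = sqrt |z_j| and v_j = z_j / w_j, the vectors w and v
   both have squared norm L, and sum z_j = 0 says exactly that they are
   orthogonal. Let M be the Hermitian matrix equal to m on w, 1/m on v and 1 on
   the orthogonal complement. Then T(z) = A B with A = Q diag(w) M and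
   B = M^-1 diag(v) Q, so 2 ||T(z)||_1 <= ||A||_2^2 + ||B||_2^2 (Hilbert-Schmidt
   norms). By the symmetry between w and v both terms equal
     L - p L / n + (p + 1/p - 2) s / L,   p = m^2,  s = sum |z_j|^2,
   and s <= L^2 / 2 because sum z_j = 0. For p = 1/r with r = sqrt ((n - 2) / n)
   this is at most r L. For n = 2 there is no such p, but then T(z) = 0. *)
Require Import Defs.
From HB Require Import structures.
From mathcomp Require Import all_boot all_order all_algebra.
From mathcomp Require Import reals.
From mathcomp Require Import complex.
From mathcomp Require Import ring.
Import Order.TTheory GRing.Theory Num.Theory.
Local Open Scope ring_scope.

(** * Conjugate transposes and Hilbert-Schmidt trace inequalities *)

Section Adjoint.
Set Implicit Arguments.
Unset Strict Implicit.
Variable C : numClosedFieldType.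

Lemma adjmxE m n (A : 'M[C]_(m, n)) i j : adjmx A i j = (A j i)^*.
Proof. by rewrite !mxE. Qed.

Lemma adjmxK m n (A : 'M[C]_(m, n)) : adjmx (adjmx A) = A.
Proof. by apply/matrixP => i j; rewrite !mxE conjCK. Qed.

Lemma adjmxM m n k (A : 'M[C]_(m, n)) (B : 'M[C]_(n, k)) :
  adjmx (A *m B) = adjmx B *m adjmx A.
Proof. by rewrite /adjmx map_mxM trmx_mul. Qed.

Lemma adjmxD m n (A B : 'M[C]_(m, n)) : adjmx (A + B) = adjmx A + adjmx B.
Proof. by apply/matrixP => i j; rewrite !mxE rmorphD. Qed.

Lemma adjmxB m n (A B : 'M[C]_(m, n)) : adjmx (A - B) = adjmx A - adjmx B.
Proof. by apply/matrixP => i j; rewrite !mxE rmorphB. Qed.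

Lemma adjmxZ m n a (A : 'M[C]_(m, n)) : adjmx (a *: A) = a^* *: adjmx A.
Proof. by apply/matrixP => i j; rewrite !mxE rmorphM. Qed.

Lemma adjmx1 n : adjmx (1%:M : 'M[C]_n) = 1%:M.
Proof. by apply/matrixP => i j; rewrite !mxE eq_sym rmorph_nat. Qed.

Lemma adjmx_diag n (d : 'rV[C]_n) :
  adjmx (diag_mx d) = diag_mx (map_mx Num.conj d).
Proof. by rewrite /adjmx map_diag_mx tr_diag_mx. Qed.

Lemma adjmx_mul0C m n k (A : 'M[C]_(m, n)) (B : 'M[C]_(m, k)) :
  adjmx A *m B = 0 -> adjmx B *m A = 0.
Proof.
move=> AB; rewrite -[LHS]adjmxK adjmxM adjmxK AB.
by apply/matrixP => i j; rewrite !mxE rmorph0.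
Qed.

Lemma adjmx_mul_col n (x : 'cV[C]_n) :
  adjmx x *m x = (\sum_j `|x j 0| ^+ 2)%:M.
Proof.
apply/matrixP => i j; rewrite !ord1 !mxE mulr1n.
by apply: eq_bigr => k _; rewrite adjmxE -normCKC.
Qed.

Lemma mxtrace_adj n (A : 'M[C]_n) : \tr (adjmx A) = (\tr A)^*.
Proof. by rewrite /mxtrace rmorph_sum; apply: eq_bigr => i _; rewrite !mxE. Qed.

Lemma mxtrace_adjmx_mul_ge0 m n (A : 'M[C]_(m, n)) : 0 <= \tr (adjmx A *m A).
Proof.
apply: sumr_ge0 => i _; rewrite mxE; apply: sumr_ge0 => j _.
by rewrite !mxE -normCKC exprn_ge0.
Qed.

(** Expand the squared Hilbert-Schmidt norm of [adjmx A - B]; the cross terms are [\tr (A *m B)] and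
    its conjugate, equal because the trace is real. *)
Lemma mxtrace_mul_le m n (A : 'M[C]_(m, n)) (B : 'M[C]_(n, m)) :
  \tr (A *m B) \is Num.real ->
  2 * \tr (A *m B) <= \tr (A *m adjmx A) + \tr (adjmx B *m B).
Proof.
move=> /CrealP trAB; rewrite -subr_ge0.
have := mxtrace_adjmx_mul_ge0 (adjmx A - B).
rewrite adjmxB adjmxK mulmxBr !mulmxBl !raddfB /= -adjmxM mxtrace_adj trAB.
by congr (0 <= _); ring.
Qed.

(** * Singular values and the trace norm of a product *)

Lemma char_poly_conj n (P A : 'M[C]_n) :
  P \in unitmx -> char_poly (invmx P *m A *m P) = char_poly A.
Proof.
move=> Pu; set pC := @polyC C.
have PI : map_mx pC (invmx P) *m map_mx pC P = 1%:M.
  by rewrite -map_mxM mulVmx // map_mx1.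
rewrite /char_poly.
have -> : char_poly_mx (invmx P *m A *m P)
        = map_mx pC (invmx P) *m char_poly_mx A *m map_mx pC P.
  rewrite /char_poly_mx !map_mxM mulmxBr mulmxBl; congr (_ - _).
  by rewrite -mulmxA -scalar_mxC mulmxA PI mul1mx.
by rewrite !det_mulmx mulrAC -det_mulmx PI det1 mul1r.
Qed.

(** The right half of a singular value decomposition: the columns of [V] form an orthonormal
    eigenbasis of the Hermitian matrix [adjmx X *m X], given by the spectral theorem. *)
Lemma right_singular_basis n (X : 'M[C]_n) :
  exists V : 'M[C]_n, exists s : 'rV[C]_n,
  [/\ V *m adjmx V = 1%:M, forall j, 0 <= s 0 j,
      adjmx (X *m V) *m (X *m V) = diag_mx (\row_j s 0 j ^+ 2)
    & trace_norm X = \sum_j s 0 j].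
Proof.
set H := adjmx X *m X.
have Hh : H \is hermsymmx.
  by apply/is_hermitianmxP; rewrite expr0 scale1r -[LHS](adjmxK H) /H adjmxM
     adjmxK -map_trmx.
have /orthomx_spectralP := hermitian_normalmx Hh.
set P := spectralmx H; set d := spectral_diag H => HE.
have Pu : P \is unitarymx by apply: spectral_unitarymx.
have adjE k l (B : 'M[C]_(k, l)) : adjmx B = map_mx Num.conj (B^T).
  by rewrite /adjmx map_trmx.
have PV : P *m adjmx P = 1%:M by rewrite adjE; apply/unitarymxP.
have VE : invmx P = adjmx P by rewrite invmx_unitary // adjE.
have DE : adjmx (X *m adjmx P) *m (X *m adjmx P) = diag_mx d.
  rewrite adjmxM adjmxK mulmxA -(mulmxA P) -/H HE VE !mulmxA PV mul1mx.
  by rewrite -mulmxA PV mulmx1.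
have d_ge0 j : 0 <= d 0 j.
  have /matrixP/(_ j j) := DE; rewrite [RHS]mxE eqxx mulr1n => <-.
  rewrite mxE; apply: sumr_ge0 => i _.
  by rewrite !mxE -normCKC exprn_ge0.
exists (adjmx P), (\row_j sqrtC (d 0 j)); split.
- by rewrite adjmxK; apply: mulmx1C.
- by move=> j; rewrite mxE sqrtC_ge0.
- by rewrite DE; congr diag_mx; apply/rowP => j; rewrite !mxE sqrtCK.
rewrite /trace_norm /singvals big_map -/H.
have -> : \sum_j (\row_j0 sqrtC (d 0 j0)) 0 j
        = \sum_(l <- [seq d 0 j | j <- enum 'I_n]) sqrtC l.
  by rewrite big_map big_enum; apply: eq_bigr => j _; rewrite mxE.
(* [eigvals] lists the roots in an unspecified order, so the two lists are compared through the
   polynomial they both factor. *)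
apply: perm_big; apply: prod_XsubC_eq.
rewrite /eigvals; case: closed_field_poly_normal => r /= rE.
rewrite (monicP (char_poly_monic H)) scale1r in rE; rewrite -rE HE.
rewrite char_poly_conj ?spectral_unit // char_poly_trig ?diag_mx_is_trig //.
rewrite big_map big_enum; apply: eq_bigr => j _.
by rewrite mxE eqxx mulr1n.
Qed.

(** Writing [A *m B *m V = U *m diag_mx s] with [U] a partial isometry turns the trace norm into the
    trace of [adjmx U *m A] times [B *m V]. The unitary [V] preserves the Hilbert-Schmidt norm of
    [B], and [adjmx U] does not increase that of [A]. *)
Lemma trace_norm_mul_le n (A B : 'M[C]_n) :
  2 * trace_norm (A *m B) <= \tr (A *m adjmx A) + \tr (adjmx B *m B).
Proof.
have [V [s [VV s0 YY ->]]] := right_singular_basis (A *m B).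
set Y := A *m B *m V in YY.
pose D := diag_mx (\row_j (s 0 j)^-1).
have Dc : adjmx D = D.
  rewrite adjmx_diag; congr diag_mx; apply/rowP => j.
  by rewrite !mxE geC0_conj ?invr_ge0.
pose U := Y *m D.
have UY : adjmx U *m Y = diag_mx s.
  rewrite adjmxM -mulmxA YY Dc mulmx_diag; congr diag_mx; apply/rowP => j.
  rewrite !mxE; have [->|sj] := eqVneq (s 0 j) 0; first by rewrite expr0n mulr0.
  by rewrite expr2 mulKf.
(* [s^-1 = 0] at [s = 0], so [U] is a partial isometry. *)
have UUU : U *m adjmx U *m U = U.
  rewrite -mulmxA {3}/U (mulmxA (adjmx U)) UY /U -(mulmxA Y) !mulmx_diag.
  congr (_ *m diag_mx _); apply/rowP => j.
  rewrite !mxE; have [->|sj] := eqVneq (s 0 j) 0; first by rewrite invr0 mul0r.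
  by rewrite mulfV // mulr1.
(* The orthogonal projection off the range of [U]: the squared norm lost in passing from [A] to
   [adjmx U *m A] is that of [N *m A]. *)
pose N := 1%:M - U *m adjmx U.
have Nc : adjmx N = N by rewrite /N adjmxB adjmx1 adjmxM adjmxK.
have NN : N *m N = N.
  by rewrite {1 3}/N mulmxBl mul1mx /N mulmxBr mulmx1 mulmxA UUU subrr subr0.
have trE : \tr (adjmx U *m A *m (B *m V)) = \sum_j s 0 j.
  by rewrite -mxtrace_diag -UY /Y !mulmxA.
rewrite -trE; apply: le_trans (mxtrace_mul_le _) _.
  by rewrite trE; apply: rpred_sum => j _; apply: ger0_real.
have -> : \tr (adjmx (B *m V) *m (B *m V)) = \tr (adjmx B *m B).
  by rewrite adjmxM -mulmxA mxtrace_mulC -!mulmxA VV mulmx1.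
rewrite lerD2r -subr_ge0.
have -> : \tr (A *m adjmx A) - \tr (adjmx U *m A *m adjmx (adjmx U *m A))
        = \tr (adjmx (N *m A) *m (N *m A)).
  rewrite [adjmx (N *m A)]adjmxM Nc -(mulmxA (adjmx A)) (mulmxA N) NN.
  rewrite /N mulmxBl mul1mx mulmxBr raddfB /= -(mxtrace_mulC A); congr (_ - _).
  by rewrite adjmxM adjmxK mxtrace_mulC !mulmxA.
exact: mxtrace_adjmx_mul_ge0.
Qed.

End Adjoint.

(** * The projection [Q], rank-two perturbations of the identity, and the trace formula *)

Section Compression.
Set Implicit Arguments.
Unset Strict Implicit.
Variables (C : numClosedFieldType) (n : nat).
Hypothesis n_gt0 : (0 < n)%N.
Let Q := Qmx C n.

Lemma adjmx_Qmx : adjmx Q = Q.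
Proof.
rewrite /Q /Qmx adjmxB adjmx1 adjmxZ geC0_conj ?invr_ge0 ?ler0n //.
by congr (_ - _ *: _); apply/matrixP => i j; rewrite !mxE rmorph1.
Qed.

Lemma const_mx1_mul m k l :
  (const_mx 1 : 'M[C]_(m, k)) *m (const_mx 1 : 'M_(k, l)) = k%:R *: const_mx 1.
Proof.
apply/matrixP => i j; rewrite !mxE (eq_bigr (fun=> 1)) => [|l' _].
  by rewrite sumr_const card_ord mulr1.
by rewrite !mxE mulr1.
Qed.

Lemma Qmx_idem : Q *m Q = Q.
Proof.
rewrite /Q /Qmx mulmxBl mul1mx mulmxBr mulmx1 -scalemxAl -scalemxAr.
rewrite const_mx1_mul (scalerA _ n%:R) mulVf ?scale1r ?subrr ?subr0 //.
by rewrite pnatr_eq0 -lt0n.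
Qed.

(** For orthogonal [x], [y] of squared norm [L], this acts as [1 + a * L] on [x], as [1 + b * L] on
    [y], and as the identity on their orthogonal complement. *)
Definition rank2_pert (x y : 'cV[C]_n) (a b : C) : 'M[C]_n :=
  1%:M + a *: (x *m adjmx x) + b *: (y *m adjmx y).

Lemma rank2_pertC x y a b : rank2_pert x y a b = rank2_pert y x b a.
Proof. by rewrite /rank2_pert addrAC. Qed.

Lemma adjmx_rank2_pert x y a b : a \is Num.real -> b \is Num.real ->
  adjmx (rank2_pert x y a b) = rank2_pert x y a b.
Proof.
move=> /CrealP ra /CrealP rb.
by rewrite /rank2_pert !adjmxD adjmx1 !adjmxZ !adjmxM !adjmxK ra rb.
Qed.

(** Eigenvalues multiply: [(1 + a * L) * (1 + c * L) = 1 + L * (a + c + L * (a * c))], and likewise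
    on [y]. *)
Lemma rank2_pertM x y L a b c d :
    adjmx x *m x = L%:M -> adjmx y *m y = L%:M -> adjmx x *m y = 0 ->
  rank2_pert x y a b *m rank2_pert x y c d =
  rank2_pert x y (a + c + L * (a * c)) (b + d + L * (b * d)).
Proof.
move=> xx yy xy.
have yx := adjmx_mul0C xy.
have mulE (u v w z : 'cV[C]_n) :
  u *m adjmx v *m (w *m adjmx z) = u *m (adjmx v *m w) *m adjmx z.
  by rewrite !mulmxA.
rewrite /rank2_pert !mulmxDl !mulmxDr !mul1mx !mulmx1.
rewrite -!scalemxAl -!scalemxAr !mulE xx yy xy yx.
rewrite !mulmx0 !mul0mx !scaler0 !addr0.
rewrite !mul_mx_scalar -!scalemxAl !scalerA.
set X := x *m _; set Y := y *m _.
apply/matrixP => i j; rewrite !mxE; ring.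
Qed.

(** Stated for a general pair so that it evaluates both factors of T(z), with the roles of w and v
    exchanged. By cyclicity the trace only involves the square of the perturbation, with eigenvalues
    [m ^+ 2] on [x] and [m ^- 2] on [y]. *)
Lemma mxtrace_compression (x y : 'cV[C]_n) (t : 'rV[C]_n) (m : C) :
    let L := \sum_j t 0 j in
    (forall j, `|x j 0| ^+ 2 = t 0 j) -> (forall j, `|y j 0| ^+ 2 = t 0 j) ->
    adjmx x *m y = 0 -> L != 0 -> 0 < m ->
  let A := Q *m diag_mx (adjmx x) *m
           rank2_pert x y ((m - 1) / L) ((m^-1 - 1) / L) in
  \tr (A *m adjmx A) = L - m ^+ 2 / n%:R * L
    + (m ^+ 2 + m ^- 2 - 2) * (\sum_j t 0 j ^+ 2) / L.
Proof.
move=> L xt yt xy L0 m0 A.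
have m0' : m != 0 by rewrite gt_eqF.
have n0 : n%:R != 0 :> C by rewrite pnatr_eq0 -lt0n.
have gram (u : 'cV[C]_n) : (forall j, `|u j 0| ^+ 2 = t 0 j) ->
    adjmx u *m u = L%:M.
  by move=> ut; rewrite adjmx_mul_col; congr _%:M; apply: eq_bigr => j _.
have xx := gram _ xt; have yy := gram _ yt.
(* Both rank-one matrices have diagonal [t], whence the sum of squares. *)
have quad (u : 'cV[C]_n) : (forall j, `|u j 0| ^+ 2 = t 0 j) ->
    \tr (u *m adjmx u *m diag_mx t) = \sum_j t 0 j ^+ 2.
  move=> ut; rewrite mul_mx_diag /mxtrace; apply: eq_bigr => j _.
  by rewrite mxE mxE big_ord1 !mxE -normCK ut.
have Lge : 0 <= L by apply: sumr_ge0 => j _; rewrite -xt exprn_ge0.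
have Lr : L \is Num.real by apply: ger0_real.
have mr : m \is Num.real by apply: gtr0_real.
have r1 : (m - 1) / L \is Num.real.
  by apply: rpredM; rewrite ?rpredV //; apply: rpredB; rewrite ?real1.
have r2 : (m^-1 - 1) / L \is Num.real.
  by apply: rpredM; rewrite ?rpredV //; apply: rpredB; rewrite ?rpredV ?real1.
have DD : adjmx (diag_mx (adjmx x)) *m diag_mx (adjmx x) = diag_mx t.
  rewrite adjmx_diag mulmx_diag; congr diag_mx; apply/rowP => j.
  by rewrite !mxE conjCK -normCK xt.
(* The diagonal factors turn the all-ones matrix into the rank-one matrix of [x], an eigenvector of
   the perturbation. *)
have DJD : adjmx (diag_mx (adjmx x)) *m const_mx 1 *m diag_mx (adjmx x)
    = x *m adjmx x.
  rewrite adjmx_diag mul_diag_mx mul_mx_diag; apply/matrixP => i j.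
  by rewrite !mxE big_ord1 !mxE conjCK mulr1.
have DQD : adjmx (diag_mx (adjmx x)) *m Q *m diag_mx (adjmx x)
    = diag_mx t - n%:R^-1 *: (x *m adjmx x).
  rewrite /Q /Qmx mulmxBr mulmx1 mulmxBl DD -scalemxAr -scalemxAl.
  by rewrite DJD.
pose K := rank2_pert x y ((m - 1) / L) ((m^-1 - 1) / L).
have -> : \tr (A *m adjmx A) =
    \tr (rank2_pert x y ((m ^+ 2 - 1) / L) ((m ^- 2 - 1) / L) *m
         (diag_mx t - n%:R^-1 *: (x *m adjmx x))).
  have -> : rank2_pert x y ((m ^+ 2 - 1) / L) ((m ^- 2 - 1) / L) = K *m K.
    rewrite (rank2_pertM _ _ _ _ xx yy xy).
    by congr rank2_pert; field; rewrite ?L0 ?m0'.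
  have AE : adjmx A *m A = K *m (diag_mx t - n%:R^-1 *: (x *m adjmx x)) *m K.
    rewrite /A -/K !adjmxM adjmx_rank2_pert // adjmx_Qmx -/K -DQD.
    by rewrite -{3}Qmx_idem !mulmxA.
  by rewrite mxtrace_mulC AE mxtrace_mulC mulmxA.
have yx0 : y *m adjmx y *m (x *m adjmx x) = 0.
  by rewrite mulmxA -(mulmxA y) (adjmx_mul0C xy) mulmx0 mul0mx.
have xx0 : x *m adjmx x *m (x *m adjmx x) = L *: (x *m adjmx x).
  by rewrite mulmxA -(mulmxA x) xx mul_mx_scalar scalemxAl.
have trx : \tr (x *m adjmx x) = L by rewrite mxtrace_mulC xx mxtrace_scalar.
rewrite /rank2_pert !mulmxDl !mulmxBr !mul1mx -!scalemxAl -!scalemxAr yx0 xx0.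
rewrite !(mxtraceD, mxtraceZ, raddfN) /= !mxtraceZ mxtrace0.
rewrite !quad // trx mxtrace_diag -/L.
by field; rewrite n0 L0 m0'.
Qed.
End Compression.

(** * Zero-sum vectors, the degenerate cases and the choice of the parameter *)

Section Bound.
Set Implicit Arguments.
Unset Strict Implicit.
Variable C : numClosedFieldType.

(** Each entry is minus the sum of the others, so twice its modulus is at most the sum of all
    moduli; multiply by the modulus and sum. *)
Lemma sum_sqr_norm_le_zero_sum n (z : 'rV[C]_n) : \sum_j z 0 j = 0 ->
  2 * \sum_j `|z 0 j| ^+ 2 <= (\sum_j `|z 0 j|) ^+ 2.
Proof.
move=> z0; rewrite expr2 mulr_sumr mulr_suml ler_sum // => j _.
rewrite expr2 mulrA mulrC ler_wpM2l // mulr_natl mulr2n (bigD1 j) //= lerD2l.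
move/eqP: z0; rewrite (bigD1 j) //= addr_eq0 => /eqP ->.
by rewrite normrN ler_norm_sum.
Qed.

(** The factorization [0 = 0 *m 0] gives this without computing eigenvalues. *)
Lemma trace_norm0_le n : trace_norm (0 : 'M[C]_n) <= 0.
Proof.
have := trace_norm_mul_le (0 : 'M[C]_n) 0.
by rewrite !mul0mx !mulmx0 mxtrace0 addr0 pmulr_rle0 ?ltr0n.
Qed.

(** The range of Q is spanned by (1, -1), which diag(-c, c) sends to a multiple of (1, 1), and Q
    kills that. *)
Lemma Tmx2_zero_sum (z : 'rV[C]_2) : \sum_j z 0 j = 0 -> Tmx z = 0.
Proof.
rewrite !big_ord_recl big_ord0 addr0 => /eqP.
rewrite addr_eq0 => /eqP z0.
have two0 : 2 != 0 :> C by rewrite pnatr_eq0.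
rewrite /Tmx mul_mx_diag; apply/matrixP => i j.
rewrite !mxE !big_ord_recl big_ord0 !mxE z0.
case: i j => [[|[|//]] ?] [[|[|//]] ?]; rewrite -!val_eqE /=;
  by field.
Qed.

Lemma trace_norm_Tmx_le n (z : 'rV[C]_n) : (2 <= n)%N -> \sum_j z 0 j = 0 ->
  trace_norm (Tmx z) <= sqrtC ((n%:R - 2) / n%:R) * \sum_j `|z 0 j|.
Proof.
move=> n2 z0; set L := \sum_j _; set r := sqrtC _.
have L_ge0 : 0 <= L by apply: sumr_ge0.
have n_gt0 : (0 < n)%N by apply: ltn_trans n2.
have n0 : n%:R != 0 :> C by rewrite pnatr_eq0 -lt0n.
have r_ge0 : 0 <= r.
  by rewrite sqrtC_ge0 divr_ge0 ?ler0n // subr_ge0 ler_nat.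
(* The case T(z) = 0 absorbs n = 2, where [r = 0], and z = 0, where [L = 0]; afterwards both can be
   inverted. *)
have [T0|T0] := eqVneq (Tmx z) 0.
  by rewrite T0 (le_trans (trace_norm0_le _)) // mulr_ge0.
have n3 : (2 < n)%N.
  rewrite ltn_neqAle n2 andbT; apply: contra_neq T0 => n2'.
  move: z z0 {L r L_ge0 n_gt0 n0 r_ge0 n2}; rewrite -n2' => z.
  exact: Tmx2_zero_sum.
have L0 : L != 0.
  apply: contra_neq T0 => L0.
  have -> : z = 0.
    apply/rowP => j; rewrite mxE; apply: normr0_eq0.
    by rewrite (psumr_eq0P _ L0).
  by rewrite /Tmx linear0 mulmx0 mul0mx.
have r_gt0 : 0 < r.
  by rewrite sqrtC_gt0 divr_gt0 ?ltr0n // subr_gt0 ltr_nat.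
have r0 : r != 0 by rewrite gt_eqF.
have rr : r ^+ 2 = (n%:R - 2) / n%:R by rewrite sqrtCK.
(* With p = m^2 and s replaced by L^2 / 2, the trace formula becomes L (p r^2 + 1/p) / 2, which is
   least at p = 1/r, with value r L. *)
pose m := sqrtC r^-1.
have m_gt0 : 0 < m by rewrite sqrtC_gt0 invr_gt0.
have m0 : m != 0 by rewrite gt_eqF.
have mm : m ^+ 2 = r^-1 by rewrite sqrtCK.
pose t := \row_j `|z 0 j|.
have tL : \sum_j t 0 j = L by apply: eq_bigr => j _; rewrite mxE.
pose w := \col_j sqrtC `|z 0 j|.
(* [v j = 0] where [z j = 0], since [0^-1 = 0]. *)
pose v := \col_j (z 0 j / sqrtC `|z 0 j|).
have wt j : `|w j 0| ^+ 2 = t 0 j.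
  by rewrite !mxE -normrX sqrtCK normr_id.
have wv j : w j 0 * v j 0 = z 0 j.
  rewrite !mxE; have [->|zj] := eqVneq (z 0 j) 0; first by rewrite mul0r mulr0.
  by rewrite mulrC divfK // sqrtC_eq0 normr_eq0.
have wr j : (w j 0)^* = w j 0 by rewrite mxE geC0_conj // sqrtC_ge0.
have vt j : `|v j 0| ^+ 2 = t 0 j.
  have [zj|zj] := eqVneq (z 0 j) 0.
    by rewrite !mxE zj mul0r normr0 expr0n.
  have w0 : `|w j 0| ^+ 2 != 0 by rewrite wt mxE normr_eq0.
  by apply: (mulfI w0); rewrite -exprMn -normrM wv wt mxE expr2.
have wvorth : adjmx w *m v = 0.
  apply/matrixP => i j; rewrite !ord1 [RHS]mxE -[RHS]z0 mxE.
  by apply: eq_bigr => k _; rewrite -wv adjmxE wr.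
have vworth := adjmx_mul0C wvorth.
(* Swapping the coefficients [a] and [b] inverts the perturbation. *)
pose a := (m - 1) / L; pose b := (m^-1 - 1) / L.
have [ra rb] : a \is Num.real /\ b \is Num.real.
  have mr : m \is Num.real by apply: gtr0_real.
  have Lr : L \is Num.real by apply: ger0_real.
  by split; apply: rpredM; rewrite ?rpredV //; apply: rpredB;
     rewrite ?rpredV ?real1.
pose A1 := Qmx C n *m diag_mx (adjmx w) *m rank2_pert w v a b.
(* The adjoint of the right factor, written in the same shape as [A1] so that one trace formula
   serves both. *)
pose A2 := Qmx C n *m diag_mx (adjmx v) *m rank2_pert v w a b.
have ww : adjmx w *m w = L%:M.
  by rewrite adjmx_mul_col -tL; congr _%:M; apply: eq_bigr.
have vv : adjmx v *m v = L%:M.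
  by rewrite adjmx_mul_col -tL; congr _%:M; apply: eq_bigr.
have PP : rank2_pert w v a b *m rank2_pert v w a b = 1%:M.
  rewrite (rank2_pertC v) (rank2_pertM _ _ _ _ ww vv wvorth).
  have -> : a + b + L * (a * b) = 0 by rewrite /a /b; field; rewrite L0 m0.
  have -> : b + a + L * (b * a) = 0 by rewrite /a /b; field; rewrite L0 m0.
  by rewrite /rank2_pert !scale0r !addr0.
have TE : Tmx z = A1 *m adjmx A2.
  rewrite /A1 /A2 !adjmxM adjmx_Qmx adjmx_rank2_pert // -!mulmxA.
  rewrite (mulmxA (rank2_pert w v a b)) PP mul1mx (mulmxA (diag_mx (adjmx w))).
  rewrite adjmx_diag mulmx_diag /Tmx -mulmxA; congr (_ *m (diag_mx _ *m _)).
  by apply/rowP => j; rewrite mxE [map_mx _ _ _ _]mxE !adjmxE conjCK wr wv.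
have := trace_norm_mul_le A1 (adjmx A2); rewrite -TE adjmxK.
have L0' : \sum_j t 0 j != 0 by rewrite tL.
rewrite /A1 /A2 /a /b -tL !mxtrace_compression // tL mm.
(* The two traces coincide, so the factor 2 cancels. *)
rewrite -[leRHS]mulr2n -[leRHS]mulr_natl.
rewrite ler_pM2l ?ltr0n // => /le_trans; apply.
have -> : \sum_j t 0 j ^+ 2 = \sum_j `|z 0 j| ^+ 2.
  by apply: eq_bigr => j _; rewrite mxE.
have sle : (\sum_j `|z 0 j| ^+ 2) / L <= L / 2.
  rewrite ler_pdivrMr ?lt0r ?L0 // mulrAC ler_pdivlMr ?ltr0n // mulrC -expr2.
  exact: sum_sqr_norm_le_zero_sum.
(* The coefficient of s / L must be nonnegative for the upper bound on s / L to apply. *)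
have c_ge0 : 0 <= r^-1 + r - 2.
  have -> : r^-1 + r - 2 = (1 - r) ^+ 2 / r by field.
  by rewrite divr_ge0 // -real_normK ?exprn_ge0 // rpredB ?real1 // ger0_real.
rewrite invrK -[_ * _ / L]mulrA.
apply: le_trans (lerD (lexx _) (ler_wpM2l c_ge0 sle)) _.
(* Rewriting half of [r] this way builds in the value of [r ^+ 2], so the last comparison is an
   identity of rational functions in [r], [L] and n. *)
have rE : r = r^-1 * ((n%:R - 2) / n%:R) by rewrite -rr expr2 mulKf.
rewrite [leRHS](_ : _ = (r / 2 + r^-1 * ((n%:R - 2) / n%:R) / 2) * L); last first.
  by rewrite -rE; field.
by rewrite le_eqVlt; apply/orP; left; apply/eqP; field; rewrite n0 r0.
Qed.
End Bound.

Theorem theorem4p1 (R : realType) (n : nat) (hn : (2 <= n)%N) (z : 'rV[R[i]]_n) :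
  \sum_(j < n) z 0 j = 0 ->
  trace_norm (Tmx z) <= sqrtC ((n%:R - 2) / n%:R) * \sum_(j < n) `|z 0 j|.
Proof. exact: trace_norm_Tmx_le. Qed.
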